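(* Let $A$ be a real $m \times n$ matrix and suppose $A = \sigma D_\alpha W D_\beta$ is a projective decomposition of $A$, so that $W$ is a scale-invariant form of $A$. Then $A^T = \sigma D_\beta W^T D_\alpha$ is a projective decomposition of the $n \times m$ matrix $A^T$; that is, $W^T$ is a scale-invariant form of $A^T$ under the same scaling constants (with row scaling factors $\beta$ and column scaling factors $\alpha$).
   Context: For a vector $x$, $D_x$ denotes the square diagonal matrix with diagonal entries $x_i$. For a vector or matrix $M$, $|M|$ denotes the root-mean-square of its entries (the square root of the average of the squares of its entries); $W_{i*}$ and $W_{*j}$ denote the $i$-th row and $j$-th column of $W$. Two real $m\times n$ matrices $A$ and $B$ are equivalent up to scale if there exist strictly positive vectors $p \in \mathbb{R}^n$, $q \in \mathbb{R}^m$ with $D_q B = A D_p$. A projective decomposition of a real $m \times n$ matrix $A$ (for any dimensions $m,n$) is an equation $A = \sigma D_\alpha W D_\beta$ (i.e. $a_{ij} = \sigma \alpha_i w_{ij} \beta_j$ for all $i,j$), where $\sigma = |A| = \sqrt{\sum_{i,j} a_{ij}^2/(mn)}$, $\alpha \in \mathbb{R}^m$ (row scaling factors) and $\beta \in \mathbb{R}^n$ (column scaling factors) are strictly positive vectors, and $W$ is a real $m \times n$ matrix equivalent up to scale with $A$ satisfying $|W_{i*}| = \sqrt{\sum_j w_{ij}^2/n} = 1$ for every row $i$ and $|W_{*j}| = \sqrt{\sum_i w_{ij}^2/m} = 1$ for every column $j$. The matrix $W$ is then called the scale-invariant form of $A$. *)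

(* Defs.v *)
From mathcomp Require Import all_boot all_order all_algebra.
From mathcomp Require Import reals.

Set Implicit Arguments.
Unset Strict Implicit.
Unset Printing Implicit Defensive.

Import Order.TTheory GRing.Theory Num.Theory.
Local Open Scope ring_scope.

(* Vectors are row vectors, so that D_x is diag_mx x. *)

(* For an empty matrix division by 0 gives the value 0. *)
Definition rms (R : realType) (m n : nat) (M : 'M[R]_(m, n)) : R :=
  Num.sqrt ((\sum_i \sum_j M i j ^+ 2) / (m * n)%:R).

Definition pos_vec (R : realType) (n : nat) (x : 'rV[R]_n) : Prop :=
  forall i, 0 < x 0 i.

Definition equiv_up_to_scale (R : realType) (m n : nat)
    (A B : 'M[R]_(m, n)) : Prop :=
  exists (p : 'rV[R]_n) (q : 'rV[R]_m),
    [/\ pos_vec p, pos_vec q & diag_mx q *m B = A *m diag_mx p].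

Record projective_decomposition (R : realType) (m n : nat)
    (A : 'M[R]_(m, n)) (sigma : R) (alpha : 'rV[R]_m) (W : 'M[R]_(m, n))
    (beta : 'rV[R]_n) : Prop := ProjectiveDecomposition {
  pd_eq : A = sigma *: (diag_mx alpha *m W *m diag_mx beta);
  pd_sigma : sigma = rms A;
  pd_alpha_pos : pos_vec alpha;
  pd_beta_pos : pos_vec beta;
  pd_equiv : equiv_up_to_scale W A;
  pd_rows : forall i, rms (row i W) = 1;
  pd_cols : forall j, rms (col j W) = 1
}.

Definition scale_invariant_form (R : realType) (m n : nat)
    (W A : 'M[R]_(m, n)) : Prop :=
  exists (sigma : R) (alpha : 'rV[R]_m) (beta : 'rV[R]_n),
    projective_decomposition A sigma alpha W beta.

(* Main.v *)
Require Import Defs.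
From mathcomp Require Import all_boot all_order all_algebra.
From mathcomp Require Import reals.
Local Open Scope ring_scope.

Import Order.TTheory GRing.Theory Num.Theory.

(** Each defining condition is stable under transposition. Transposing reverses the product
    $D_\alpha W D_\beta$ and fixes diagonal matrices. The root-mean-square depends only on the
    entries and their number ([rms_tr]), so $\sigma$ is unchanged and the norm conditions on rows
    and columns trade places. Scale equivalence survives because it is symmetric and transposition
    reverses its direction ([equiv_up_to_scale_sym], [equiv_up_to_scale_tr]). *)

Lemma rms_tr (R : realType) (m n : nat) (M : 'M[R]_(m, n)) : rms M^T = rms M.
Proof.
rewrite /rms exchange_big mulnC; congr (Num.sqrt (_ / _)).
by apply: eq_bigr => i _; apply: eq_bigr => j _; rewrite mxE.
Qed.

Lemma pos_vec_inv (R : realType) (n : nat) (x : 'rV[R]_n) :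
  pos_vec x -> pos_vec (map_mx GRing.inv x).
Proof. by move=> x_gt0 i; rewrite mxE invr_gt0. Qed.

Lemma diag_mx_mulV (R : realType) (n : nat) (x : 'rV[R]_n) :
  pos_vec x -> diag_mx x *m diag_mx (map_mx GRing.inv x) = 1%:M.
Proof.
move=> x_gt0; rewrite mulmx_diag -diag_const_mx; congr diag_mx.
by apply/rowP => i; rewrite !mxE divff ?gt_eqF.
Qed.

(** Multiplying $D_q B = A D_p$ by $D_q^{-1}$ on the left and $D_p^{-1}$ on the right gives
    $D_q^{-1} A = B D_p^{-1}$, so the entrywise inverses of [p] and [q] are the witnesses. *)
Lemma equiv_up_to_scale_sym (R : realType) (m n : nat) (A B : 'M[R]_(m, n)) :
  equiv_up_to_scale A B -> equiv_up_to_scale B A.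
Proof.
move=> [p [q [p_gt0 q_gt0 qBAp]]].
exists (map_mx GRing.inv p), (map_mx GRing.inv q).
split; try exact: pos_vec_inv.
have ->: A = diag_mx q *m B *m diag_mx (map_mx GRing.inv p).
  by rewrite qBAp -mulmxA diag_mx_mulV ?mulmx1.
by rewrite !mulmxA diag_mxC diag_mx_mulV ?mul1mx.
Qed.

(* Transposition turns D_q B = A D_p into D_p A^T = B^T D_q, which exchanges
   the two matrices. *)
Lemma equiv_up_to_scale_tr (R : realType) (m n : nat) (A B : 'M[R]_(m, n)) :
  equiv_up_to_scale A B -> equiv_up_to_scale B^T A^T.
Proof.
move=> [p [q [p_gt0 q_gt0 qBAp]]]; exists q, p; split=> //.
by have := congr1 trmx qBAp; rewrite !trmx_mul !tr_diag_mx.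
Qed.

Lemma projective_decomposition_tr (R : realType) (m n : nat)
    (A : 'M[R]_(m, n)) (sigma : R) (alpha : 'rV[R]_m) (W : 'M[R]_(m, n))
    (beta : 'rV[R]_n) :
  projective_decomposition A sigma alpha W beta ->
  projective_decomposition A^T sigma beta W^T alpha.
Proof.
case=> defA def_sigma alpha_gt0 beta_gt0 eqWA rowsW colsW; split=> //.
- by rewrite {1}defA linearZ /= !trmx_mul !tr_diag_mx mulmxA.
- by rewrite rms_tr.
(* Symmetry compensates for the exchange of the two matrices under transposition. *)
- exact/equiv_up_to_scale_tr/equiv_up_to_scale_sym.
- by move=> i; rewrite -tr_col rms_tr.
- by move=> j; rewrite -tr_row rms_tr.
Qed.

Theorem mainTheorem3 (R : realType) (m n : nat) (A : 'M[R]_(m, n))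
    (sigma : R) (alpha : 'rV[R]_m) (W : 'M[R]_(m, n)) (beta : 'rV[R]_n)
    (hA : projective_decomposition A sigma alpha W beta) :
  projective_decomposition A^T sigma beta W^T alpha
  /\ scale_invariant_form W^T A^T.
Proof.
have hAT := projective_decomposition_tr _ _ _ _ _ _ _ _ hA.
by split=> //; exists sigma, beta, alpha.
Qed.
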